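(* Let $u$ be a distribution on $\mathbb{F}^n$ that is homogeneous of some degree $\chi_\Lambda$. Then: (1) for $x\neq0$ and $\xi\neq0$: $(x,\xi)\in\mathrm{WF}(u)$ if and only if $(\xi,-x)\in\mathrm{WF}(\mathcal F u)$; (2) for $x\neq0$: $x\in\mathrm{supp}\,u$ if and only if $(0,-x)\in\mathrm{WF}(\mathcal F u)$; (3) for $\xi\neq0$: $\xi\in\mathrm{supp}\,\mathcal F u$ if and only if $(0,\xi)\in\mathrm{WF}(u)$.
   Context: $\mathbb{F}$ is a non-archimedean local field of characteristic $0$ with ring of integers $\mathfrak o_{\mathbb{F}}$, uniformizer $\varpi$, absolute value $|\cdot|$, $|x|=\max_i|x_i|$ on $\mathbb{F}^n$; $\chi$ is a character of $(\mathbb{F},+)$ with kernel $\mathfrak o_{\mathbb{F}}$; $\mathcal F\phi(\xi)=\int\phi(x)\chi(-x\cdot\xi)dx$ with $x\cdot\xi=\sum x_j\xi_j$ and self-dual Haar measure, extended to distributions by $\mathcal F u(\phi)=u(\mathcal F\phi)$ (and to compactly supported $v$ by $\mathcal Fv(\xi)=v(\chi(-\,\cdot\,\xi))$). $\mathcal S(\mathbb{F}^n)$: locally constant compactly supported functions; distributions: its dual. A finite index subgroup $\Lambda\subseteq\mathbb{F}^\times$ with $\varpi\in\Lambda$ is fixed. A distribution $u$ is homogeneous of degree $\chi_\Lambda$, for a homomorphism $\chi_\Lambda:\Lambda\to\mathbb C^\times$, if $u(\phi_\lambda)=\chi_\Lambda(\lambda)u(\phi)$ for all $\lambda\in\Lambda$,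 $\phi\in\mathcal S(\mathbb{F}^n)$, where $\phi_\lambda(x)=|\lambda|^{-n}\phi(\lambda^{-1}x)$. A cone is a $\Lambda$-stable subset of $\mathbb{F}^n\setminus0$; $\mathrm{AC}(A)$ is the complement in $\mathbb{F}^n\setminus0$ of the union of open cones meeting $A$ in a bounded set; for compactly supported $v$, $\Sigma(v)=\mathrm{AC}(\mathrm{supp}\,\mathcal F v)$; $\Sigma_x(u)=\bigcap_{\phi\in\mathcal S,\phi(x)\neq0}\Sigma(\phi u)$; $\mathrm{WF}(u)=\{(x,\xi)\in\mathbb{F}^n\times(\mathbb{F}^n\setminus0):\xi\in\Sigma_x(u)\}$. *)

(* Defs.v *)
From HB Require Import structures.
From mathcomp Require Import all_boot all_order all_algebra.
From mathcomp Require Import reals.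
From mathcomp Require Import complex.
Set Implicit Arguments. Unset Strict Implicit. Unset Printing Implicit Defensive.
Import Order.TTheory GRing.Theory Num.Theory.
Local Open Scope ring_scope.

Section LocalField.
Variables (F : fieldType) (v : F -> int).

(* x \in varpi^k o_F  (v is only meaningful on nonzero elements) *)
Definition inball (k : int) (x : F) : Prop := x = 0 \/ k <= v x.
Definition integral_elt (x : F) : Prop := inball 0 x.

(* F is a non-archimedean local field of characteristic 0, with normalized
   discrete valuation v, uniformizer w and residue field of cardinality q. *)
Definition is_nonarch_local_field_char0 (w : F) (q : nat) : Prop :=
  [/\ (forall x y, x != 0 -> y != 0 -> v (x * y) = v x + v y),
      (forall x y, x != 0 -> y != 0 -> x + y != 0 ->
         Num.min (v x) (v y) <= v (x + y)),
      w != 0 /\ v w = 1,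
      ((1 < q)%N /\ exists r : 'I_q -> F,
         [/\ forall i, integral_elt (r i),
             forall i j, inball 1 (r i - r j) -> i = j &
             forall x, integral_elt x -> exists i, inball 1 (x - r i)]) &
      (forall a : nat -> F,
         (forall k : int, exists N : nat, forall m m' : nat,
            (N <= m)%N -> (N <= m')%N -> inball k (a m - a m')) ->
         exists L, forall k : int, exists N : nat, forall m : nat,
            (N <= m)%N -> inball k (a m - L))]
  /\
      (forall m : nat, (m.+1)%:R != 0 :> F).

(* Lam is a finite index subgroup of F^x containing the uniformizer w *)
Definition is_Lambda (Lam : F -> Prop) (w : F) : Prop :=
  [/\ (forall l, Lam l -> l != 0) /\ Lam 1,
      forall l m, Lam l -> Lam m -> Lam (l * m),
      forall l, Lam l -> Lam l^-1,
      Lam w &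
      exists s : seq F, forall x, x != 0 ->
         exists2 r, r \in s & exists l, Lam l /\ x = r * l].

Variable R : realType.
Local Notation C := R[i].

Definition absF (q : nat) (x : F) : C :=
  if x == 0 then 0 else (q%:R : C) ^ (- v x).

Definition is_char_kernel_o (chi : F -> C) : Prop :=
  (forall a b, chi (a + b) = chi a * chi b) /\
  (forall x, chi x = 1 <-> integral_elt x).

Variable n : nat.
Local Notation V := 'rV[F]_n.

(* x \in varpi^k o_F^n, i.e. |x| = max_i |x_i| <= q^{-k} *)
Definition inballn (k : int) (x : V) : Prop := forall i, inball k (x ord0 i).

Definition dot (x y : V) : F := \sum_i x ord0 i * y ord0 i.

Definition bounded (A : V -> Prop) : Prop :=
  exists k : int, forall x, A x -> inballn k x.

Definition closure (A : V -> Prop) : V -> Prop :=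
  fun x => forall k : int, exists a, A a /\ inballn k (x - a).

(* S(F^n): locally constant, compactly supported functions *)
Definition is_schwartz (f : V -> C) : Prop :=
  (forall x, exists k : int, forall y, inballn k y -> f (x + y) = f x) /\
  bounded (fun x => f x != 0).

Definition fourier (chi : F -> C) (I : (V -> C) -> C) (f : V -> C) : V -> C :=
  fun xi => I (fun x => f x * chi (- dot x xi)).

Definition is_haar_integral (I : (V -> C) -> C) : Prop :=
  [/\ forall (a : C) f g, is_schwartz f -> is_schwartz g ->
        I (fun x => a * f x + g x) = a * I f + I g,
      forall f a, is_schwartz f -> I (fun x => f (x + a)) = I f,
      forall f, is_schwartz f -> (forall x, 0 <= f x) -> 0 <= I f &
      exists2 f, is_schwartz f & I f != 0].

Definition self_dual (chi : F -> C) (I : (V -> C) -> C) : Prop :=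
  forall f, is_schwartz f -> forall x, fourier chi I (fourier chi I f) x = f (- x).

(* distributions: linear functionals on S(F^n) (values off S are irrelevant) *)
Definition is_distribution (u : (V -> C) -> C) : Prop :=
  forall (a : C) f g, is_schwartz f -> is_schwartz g ->
    u (fun x => a * f x + g x) = a * u f + u g.

Definition fourier_dist (chi : F -> C) (I : (V -> C) -> C) (u : (V -> C) -> C)
  : (V -> C) -> C := fun f => u (fourier chi I f).

Definition dsupp (u : (V -> C) -> C) (x : V) : Prop :=
  ~ exists k : int, forall f, is_schwartz f ->
      (forall y, f y != 0 -> inballn k (y - x)) -> u f = 0.

Definition is_homogeneous (q : nat) (Lam : F -> Prop) (u : (V -> C) -> C) : Prop :=
  exists chiL : F -> C,
    [/\ forall l m, Lam l -> Lam m -> chiL (l * m) = chiL l * chiL m,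
        forall l, Lam l -> chiL l != 0 &
        forall l f, Lam l -> is_schwartz f ->
          u (fun x => (absF q l)^-1 ^+ n * f (l^-1 *: x)) = chiL l * u f].

Definition is_cone (Lam : F -> Prop) (G : V -> Prop) : Prop :=
  (forall x, G x -> x != 0) /\ (forall l x, Lam l -> G x -> G (l *: x)).

Definition is_open (G : V -> Prop) : Prop :=
  forall x, G x -> exists k : int, forall y, inballn k y -> G (x + y).

Definition AC (Lam : F -> Prop) (A : V -> Prop) (xi : V) : Prop :=
  xi != 0 /\
  ~ exists G, [/\ is_cone Lam G, is_open G, G xi & bounded (fun y => G y /\ A y)].

(* Fourier transform of the compactly supported distribution phi u:
   F(phi u)(xi) = (phi u)(chi(- . xi)) = u(phi chi(- . xi)) *)
Definition fourier_cs (chi : F -> C) (phi : V -> C) (u : (V -> C) -> C) : V -> C :=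
  fun xi => u (fun x => phi x * chi (- dot x xi)).

Definition fsupp (g : V -> C) : V -> Prop := closure (fun xi => g xi != 0).

Definition Sigma_at (Lam : F -> Prop) (chi : F -> C) (u : (V -> C) -> C)
  (x xi : V) : Prop :=
  forall phi, is_schwartz phi -> phi x != 0 ->
    AC Lam (fsupp (fourier_cs chi phi u)) xi.

Definition WF (Lam : F -> Prop) (chi : F -> C) (u : (V -> C) -> C)
  (x xi : V) : Prop := xi != 0 /\ Sigma_at Lam chi u x xi.

End LocalField.

(* Main.v *)
(** Test a distribution [u] against the wave packets
    [e(a, k, eta) = 1_{a + w^k o^n} chi(- . eta)]. Only the vanishing of
    [u (e(a, k, eta))] matters. The Fourier transform sends [e(a, k, eta)] to a
    nonzero multiple of [e(- eta, - k, a)], and by homogeneity vanishing at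
    [(a, k, eta)] and at [(l a, k + v l, l^-1 eta)] are equivalent for [l] in
    [Lam]. By compactness of balls, [x] lies outside the support of [u] iff [u]
    kills [e(a, j, 0)] for [a] near [x] and [j] large; by Fourier inversion,
    [(x, xi)] lies outside the wave front set iff, for some fixed [k], [u] kills
    [e(x, k, l eta)] for [eta] near [xi] and [l] in [Lam] large. The three
    equivalences follow by rescaling these conditions. *)

Require Import Defs.
From HB Require Import structures.
From mathcomp Require Import all_boot all_order all_algebra.
From mathcomp Require Import boolp reals.
From mathcomp Require Import complex.
From mathcomp Require Import zify ring.
Import Order.TTheory GRing.Theory Num.Theory.
Local Open Scope ring_scope.

(** * The valuation and its ultrametric balls *)

Section Valuation.
Set Implicit Arguments.
Unset Strict Implicit.
Context (F : fieldType) (v : F -> int) (w : F) (q : nat).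
Hypothesis HF : is_nonarch_local_field_char0 v w q.

Lemma valM x y : x != 0 -> y != 0 -> v (x * y) = v x + v y.
Proof. by case: HF => -[vM _ _ _ _] _; exact: vM. Qed.

Lemma val1 : v 1 = 0.
Proof.
have n1 : (1 : F) != 0 := oner_neq0 F.
by have := valM n1 n1; rewrite mulr1; lia.
Qed.

Lemma valN1 : v (-1) = 0.
Proof.
have n1 : (-1 : F) != 0 by rewrite oppr_eq0 oner_neq0.
by have := valM n1 n1; rewrite mulrNN mulr1 val1; lia.
Qed.

Lemma valV x : x != 0 -> v x^-1 = - v x.
Proof.
move=> x0; have := valM x0 (y := x^-1).
by rewrite invr_eq0 mulfV // val1 => /(_ x0); lia.
Qed.

Lemma unif_neq0 : w != 0.
Proof. by case: HF => -[_ _ [] ]. Qed.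

Lemma unif_expz_neq0 (k : int) : w ^ k != 0.
Proof. by rewrite expfz_eq0 (negbTE unif_neq0) andbF. Qed.

Lemma val_unif_expz (k : int) : v (w ^ k) = k.
Proof.
have w0 := unif_neq0; have vw : v w = 1 by case: HF => -[_ _ [] ].
have nat_case (m : nat) : v (w ^+ m) = m.
  elim: m => [|m IH]; first by rewrite expr0 val1.
  by rewrite exprS valM ?expf_neq0 // IH vw; lia.
case: k => m; first exact: nat_case.
by rewrite NegzE -exprnN valV ?expf_neq0 // nat_case.
Qed.

Lemma inball0 k : inball v k 0.
Proof. by left. Qed.

Lemma inball_le k l x : k <= l -> inball v l x -> inball v k x.
Proof. by move=> kl [->|lx]; [left|right; lia]. Qed.

Lemma inballD k x y : inball v k x -> inball v k y -> inball v k (x + y).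
Proof.
have [->|x0] := eqVneq x 0; first by rewrite add0r.
have [->|y0] := eqVneq y 0; first by rewrite addr0.
have [->|xy0] := eqVneq (x + y) 0; first by left.
case=> [/eqP|kx]; first by rewrite (negbTE x0).
case=> [/eqP|ky]; first by rewrite (negbTE y0).
right; case: HF => -[_ vD _ _ _] _.
by apply: le_trans (vD _ _ x0 y0 xy0); rewrite le_min kx ky.
Qed.

Lemma inballM k l x y : inball v k x -> inball v l y -> inball v (k + l) (x * y).
Proof.
have [->|x0] := eqVneq x 0; first by rewrite mul0r; left.
have [->|y0] := eqVneq y 0; first by rewrite mulr0; left.
case=> [/eqP|kx]; first by rewrite (negbTE x0).
case=> [/eqP|ky]; first by rewrite (negbTE y0).
by right; rewrite valM // lerD.
Qed.

Lemma inballN k x : inball v k x -> inball v k (- x).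
Proof.
move=> kx; rewrite -mulN1r -[k]add0r; apply: inballM => //.
by right; rewrite valN1.
Qed.

Lemma inballB k x y : inball v k x -> inball v k y -> inball v k (x - y).
Proof. by move=> kx ky; apply: inballD => //; exact: inballN. Qed.

Lemma inball_sum (T : finType) k (f : T -> F) :
  (forall i, inball v k (f i)) -> inball v k (\sum_i f i).
Proof.
move=> fk; elim/big_ind: _ => //; first exact: inball0.
exact: inballD.
Qed.

Lemma inball_scale k l x : l != 0 -> inball v (k + v l) (l * x) <-> inball v k x.
Proof.
move=> l0; split=> [h|h]; last first.
  by rewrite addrC; apply: inballM => //; right.
have -> : x = l^-1 * (l * x) by rewrite mulrA mulVf // mul1r.
apply: (@inball_le _ (- v l + (k + v l))); first by lia.
by apply: inballM => //; right; rewrite valV.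
Qed.

(** * Balls, pairing and completeness in the vector space *)

Variable n : nat.
Local Notation V := 'rV[F]_n.

Lemma inballn0 k : inballn v k (0 : V).
Proof. by move=> i; rewrite mxE; left. Qed.

Lemma inballn_le k l (x : V) : k <= l -> inballn v l x -> inballn v k x.
Proof. by move=> kl lx i; apply: inball_le (lx i). Qed.

Lemma inballnD k (x y : V) : inballn v k x -> inballn v k y -> inballn v k (x + y).
Proof. by move=> kx ky i; rewrite mxE; apply: inballD. Qed.

Lemma inballnN k (x : V) : inballn v k x -> inballn v k (- x).
Proof. by move=> kx i; rewrite mxE; apply: inballN. Qed.

Lemma inballnB k (x y : V) : inballn v k x -> inballn v k y -> inballn v k (x - y).
Proof. by move=> kx ky; apply: inballnD => //; exact: inballnN. Qed.

Lemma inballn_subC k (x y : V) : inballn v k (x - y) -> inballn v k (y - x).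
Proof. by move=> h; rewrite -opprB; exact: inballnN. Qed.

Lemma inballn_subD k (x y z : V) :
  inballn v k (x - y) -> inballn v k (y - z) -> inballn v k (x - z).
Proof. by move=> h1 h2; rewrite -(subrKA y x (- z)); exact: inballnD. Qed.

Lemma inballn_scale k l (x : V) :
  l != 0 -> inballn v (k + v l) (l *: x) <-> inballn v k x.
Proof.
by move=> l0; split=> h i; have := h i; rewrite mxE => /(inball_scale _ _ l0).
Qed.

Lemma inballn_ex (x : V) : exists k, inballn v k x.
Proof.
(* Minus the sum of all absolute valuations lies below each of them; a zero coordinate is covered
   too, whatever the value [v 0]. *)
exists (- ((\sum_i `|v (x ord0 i)|)%N : int)) => i; right.
by rewrite (bigD1 i) //=; lia.
Qed.

Lemma dotDl (x y z : V) : dot (x + y) z = dot x z + dot y z.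
Proof.
by rewrite /dot -big_split; apply: eq_bigr => i _; rewrite mxE mulrDl.
Qed.

Lemma dotC (x y : V) : dot x y = dot y x.
Proof. by apply: eq_bigr => i _; rewrite mulrC. Qed.

Lemma dotDr (x y z : V) : dot x (y + z) = dot x y + dot x z.
Proof. by rewrite dotC dotDl !(dotC x). Qed.

Lemma dotZl a (x y : V) : dot (a *: x) y = a * dot x y.
Proof.
by rewrite /dot mulr_sumr; apply: eq_bigr => i _; rewrite mxE mulrA.
Qed.

Lemma dotZr a (x y : V) : dot x (a *: y) = a * dot x y.
Proof. by rewrite dotC dotZl dotC. Qed.

Lemma dot0r (x : V) : dot x 0 = 0.
Proof. by rewrite -(scale0r x) dotZr mul0r. Qed.

Lemma inball_dot k l (x y : V) :
  inballn v k x -> inballn v l y -> inball v (k + l) (dot x y).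
Proof. by move=> kx ly; apply: inball_sum => i; exact: inballM. Qed.

(** Completeness gives a limit in each coordinate, and ultrametric balls are closed, so the limit
    stays in every ball of the sequence. *)
Lemma nested_balls (k0 : int) (a : nat -> V) :
  (forall m l : nat, inballn v (k0 + m%:Z) (a (m + l)%N - a m)) ->
  exists L : V, forall m : nat, inballn v (k0 + m%:Z) (L - a m).
Proof.
move=> ha.
have aC m m' : (m <= m')%N -> inballn v (k0 + m%:Z) (a m' - a m).
  by move=> mm'; rewrite -(subnKC mm').
have lim i : exists l, forall k : int, exists N : nat, forall m : nat,
    (N <= m)%N -> inball v k (a m ord0 i - l).
  case: HF => -[_ _ _ _ /(_ (fun m => a m ord0 i))] + _; apply=> k.
  exists `|k - k0|%N => m m' Nm Nm'.
  apply: (@inball_le _ (k0 + `|k - k0|%N%:Z)); first by lia.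
  have := inballn_subD (aC _ _ Nm) (inballn_subC (aC _ _ Nm')).
  by move=> /(_ i); rewrite !mxE.
have [L hL] := choice lim.
exists (\row_i L i) => m i.
have [N hN] := hL i (k0 + m%:Z).
have h1 := hN _ (leq_maxl N m).
have := aC _ _ (leq_maxr N m) => /(_ i); rewrite !mxE => h2.
have := inballB h2 h1; congr inball; ring.
Qed.

End Valuation.

(** * Schwartz functions as combinations of ball indicators *)

Section Schwartz.
Set Implicit Arguments.
Unset Strict Implicit.
Context (R : realType) (F : fieldType) (v : F -> int) (w : F) (q n : nat).
Hypothesis HF : is_nonarch_local_field_char0 v w q.
Local Notation C := R[i].
Local Notation V := 'rV[F]_n.

Definition ball_ind (a : V) (k : int) (x : V) : C :=
  (`[< inballn v k (x - a) >] : bool)%:R.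

Lemma ball_ind1 a k x : inballn v k (x - a) -> ball_ind a k x = 1.
Proof. by move=> h; rewrite /ball_ind asboolT. Qed.

Lemma ball_ind0 a k x : ~ inballn v k (x - a) -> ball_ind a k x = 0.
Proof. by move=> h; rewrite /ball_ind asboolF. Qed.

Lemma ball_ind_neq0 a k x : ball_ind a k x != 0 -> inballn v k (x - a).
Proof.
by case: (pselect (inballn v k (x - a))) => // /ball_ind0 ->; rewrite eqxx.
Qed.

Lemma ball_ind_eq a b k x y :
  (inballn v k (x - a) <-> inballn v k (y - b)) -> ball_ind a k x = ball_ind b k y.
Proof.
by move=> h; congr (nat_of_bool _)%:R; exact: asbool_equiv_eq.
Qed.

Definition loc_const (f : V -> C) : Prop :=
  forall x, exists k : int, forall y, inballn v k y -> f (x + y) = f x.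

Lemma loc_const2 (f g : V -> C) (op : C -> C -> C) :
  loc_const f -> loc_const g -> loc_const (fun x => op (f x) (g x)).
Proof.
move=> hf hg x; have [k hk] := hf x; have [l hl] := hg x.
exists (Num.max k l) => y hy.
by rewrite hk ?hl //; apply: inballn_le hy; lia.
Qed.

Lemma schwartz_lin (a : C) (f g : V -> C) :
  is_schwartz v f -> is_schwartz v g -> is_schwartz v (fun x => a * f x + g x).
Proof.
move=> [lf [k hk]] [lg [l hl]]; split.
  exact: (loc_const2 (fun s t => a * s + t)).
exists (Num.min k l) => x /=.
have [fx0|fx0] := eqVneq (f x) 0.
  by rewrite fx0 mulr0 add0r => /hl; apply: inballn_le; lia.
by move=> _; apply: inballn_le (hk _ fx0); lia.
Qed.

Lemma schwartzM (f g : V -> C) :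
  is_schwartz v f -> loc_const g -> is_schwartz v (fun x => f x * g x).
Proof.
move=> [lf [k hk]] lg; split; first exact: (loc_const2 (fun s t => s * t)).
by exists k => x; rewrite mulf_eq0 negb_or => /andP[/hk hx _].
Qed.

Lemma schwartz0 : is_schwartz v (fun _ : V => 0 : C).
Proof. by split=> [x|]; [exists 0|exists 0 => x; rewrite eqxx]. Qed.

Lemma ball_ind_schwartz a k : is_schwartz v (ball_ind a k).
Proof.
split=> [x|].
  exists k => y hy; apply: ball_ind_eq; rewrite addrAC.
  split=> h; last exact: (inballnD HF h hy).
  by rewrite -[x - a](addrK y); exact: (inballnB HF h hy).
have [l hl] := inballn_ex v a; exists (Num.min k l) => x /ball_ind_neq0 h.
rewrite -[x](subrK a); apply: (inballnD HF).
  by apply: inballn_le h; lia.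
by apply: inballn_le hl; lia.
Qed.

(** The residue digits of the coordinates of [w ^ (- k) *: (x - a)] select one of [q ^ n] smaller
    balls; since the representatives [r] are distinct modulo [w], only one ball contains [x]. *)
Lemma ball_subdivide (a : V) (k : int) :
  exists (T : finType) (b : T -> V), (forall t, inballn v k (b t - a)) /\
    forall x, ball_ind a k x = \sum_t ball_ind (b t) (k + 1) x.
Proof.
case: (HF) => -[_ _ _ [_ [r [r_int r_inj r_surj]]] _] _.
have wk0 := unif_expz_neq0 HF k.
have scale1 l y : inball v (k + l) (w ^ k * y) <-> inball v l y.
  have := inball_scale HF l y wk0.
  by rewrite (val_unif_expz HF) addrC.
pose b (t : {ffun 'I_n -> 'I_q}) : V := a + w ^ k *: \row_i r (t i).
have hb t : inballn v k (b t - a).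
  move=> i; rewrite /b addrC addKr !mxE -{1}[k]addr0.
  by apply/scale1; exact: r_int.
exists {ffun 'I_n -> 'I_q}, b; split=> // x.
case: (pselect (inballn v k (x - a))) => hx; last first.
  rewrite ball_ind0 // big1 // => t _; apply: ball_ind0 => ht; apply: hx.
  apply: (inballn_subD HF) (hb t).
  by apply: inballn_le ht; lia.
have digit i : exists j : 'I_q, inball v (k + 1) ((x - a) ord0 i - w ^ k * r j).
  have := hx i; set y := (x - a) ord0 i => hy.
  have yE : y = w ^ k * (w ^ (- k) * y).
    by rewrite mulrA -expfzDr ?(unif_neq0 HF) // subrr expr0z mul1r.
  have [j hj] : exists j, inball v 1 (w ^ (- k) * y - r j).
    by apply: r_surj; apply/scale1; rewrite -yE addr0.
  by exists j; rewrite yE -mulrBr; apply/scale1.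
have [g hg] := choice digit.
have coord t i : (x - b t) ord0 i = (x - a) ord0 i - w ^ k * r (t i).
  by rewrite /b !mxE; ring.
rewrite ball_ind1 // (bigD1 [ffun i => g i]) //= ball_ind1; last first.
  by move=> i; rewrite coord ffunE.
rewrite big1 ?addr0 // => t /eqP tg; apply: ball_ind0 => ht; apply: tg.
apply/ffunP => i; rewrite ffunE; apply: r_inj; apply/scale1.
have := ht i; rewrite coord => hti.
by have := inballB HF (hg i) hti; congr inball; ring.
Qed.

Lemma lin_closed_sum (P : (V -> C) -> Prop) (T : finType) (g : T -> V -> C) :
  P (fun _ => 0) ->
  (forall c g h, P g -> P h -> P (fun x => c * g x + h x)) ->
  (forall t, P (g t)) -> P (fun x => \sum_t g t x).
Proof.
move=> P0 Plin Pg; elim: (index_enum T) => [|t s IH].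
  by have -> : (fun x => \sum_(t <- [::]) g t x) = fun _ => 0
    by apply: funext => x; rewrite big_nil.
have -> : (fun x => \sum_(j <- t :: s) g j x) =
    fun x => 1 * g t x + \sum_(j <- s) g j x.
  by apply: funext => x; rewrite big_cons mul1r.
exact: Plin.
Qed.

(* A Schwartz function is a linear combination of indicators of balls on which
   it is constant: otherwise some ball carries a counterexample, subdivision
   yields a nested sequence of such balls, and local constancy at their common
   point is contradicted. *)
Lemma schwartz_ind (f : V -> C) (J : int) (P : (V -> C) -> Prop) :
  is_schwartz v f ->
  P (fun _ => 0) ->
  (forall c g h, P g -> P h -> P (fun x => c * g x + h x)) ->
  (forall a k, J <= k -> f a != 0 -> (forall x, inballn v k (x - a) -> f x = f a) ->
     P (ball_ind a k)) ->
  P f.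
Proof.
move=> [lf [K hK]] P0 Plin Pball.
pose cut p := fun x => f x * ball_ind p.1 p.2 x.
have cut_const (a : V) k : J <= k ->
    (forall x, inballn v k (x - a) -> f x = f a) -> P (cut (a, k)).
  move=> Jk fa.
  have -> : cut (a, k) = fun x => f a * ball_ind a k x + 0.
    apply: funext => x; rewrite /cut /= addr0.
    case: (pselect (inballn v k (x - a))) => h; first by rewrite fa.
    by rewrite !ball_ind0 // !mulr0.
  have [fa0|fa0] := eqVneq (f a) 0.
    have -> // : (fun x => f a * ball_ind a k x + 0) = fun _ => 0.
    by apply: funext => x; rewrite fa0 mul0r addr0.
  by apply: (Plin (f a) _ (fun _ => 0)) => //; exact: Pball.
have fE : f = cut (0, K).
  apply: funext => x; rewrite /cut /=.
  have [->|fx0] := eqVneq (f x) 0; first by rewrite mul0r.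
  by rewrite ball_ind1 ?mulr1 // subr0; exact: hK.
apply: contrapT; rewrite {1}fE => bad0.
(* The implication is placed under the existential so that [choice] yields a total step function;
   its value off the counterexamples is irrelevant. *)
have bad_sub (p : V * int) : exists p' : V * int, ~ P (cut p) ->
    [/\ p'.2 = p.2 + 1, inballn v p.2 (p'.1 - p.1) & ~ P (cut p')].
  case: p => a k; have [T [b [bP bE]]] := ball_subdivide a k.
  case: (pselect (exists t, ~ P (cut (b t, k + 1)))) => [[t ht]|nobad].
    by exists (b t, k + 1) => _; split=> //; exact: bP.
  exists (a, k) => badp; exfalso; apply: badp.
  have -> : cut (a, k) = fun x => \sum_t cut (b t, k + 1) x.
    by apply: funext => x; rewrite /cut bE mulr_sumr.
  apply: lin_closed_sum => // t.
  by apply: contrapT => h; apply: nobad; exists t.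
have [step stepP] := choice bad_sub.
pose s m := iter m step (0, K).
have s_bad m : ~ P (cut (s m)).
  by elim: m => [//|m IH]; have [] := stepP _ IH.
have s_rad m : (s m).2 = K + m%:Z.
  elim: m => [|m IH]; first by rewrite addr0.
  by have [-> _ _] := stepP _ (s_bad m); rewrite IH; lia.
have s_nest m l : inballn v (K + m%:Z) ((s (m + l)%N).1 - (s m).1).
  elim: l => [|l IH]; first by rewrite addn0 subrr; exact: inballn0.
  rewrite addnS; apply: (inballn_subD HF) IH.
  have [_ + _] := stepP _ (s_bad (m + l)%N).
  by rewrite s_rad; apply: inballn_le; lia.
have [L hL] := nested_balls HF s_nest.
have [k hk] := lf L.
(* This makes [K + m] at least the radius exponent [k] of local constancy at [L] and at least the
   required bound [J]. *)
pose m := (`|k - K| + `|J - K|)%N.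
apply: (s_bad m); rewrite [s m]surjective_pairing s_rad.
have fL x : inballn v (K + m%:Z) (x - (s m).1) -> f x = f L.
  move=> hx; rewrite -(subrK L x) addrC; apply: hk.
  apply: inballn_le (inballn_subD HF hx (inballn_subC HF (hL m))).
  by rewrite /m; lia.
apply: cut_const; first by rewrite /m; lia.
by move=> x hx; rewrite (fL x hx) fL // subrr; exact: inballn0.
Qed.
End Schwartz.

(** * Additive characters and wave packets *)

Section Fourier.
Set Implicit Arguments.
Unset Strict Implicit.
Context (R : realType) (F : fieldType) (v : F -> int) (w : F) (q n : nat).
Context (chi : F -> R[i]) (I : ('rV[F]_n -> R[i]) -> R[i]).
Hypothesis HF : is_nonarch_local_field_char0 v w q.
Hypothesis Hchi : is_char_kernel_o v chi.
Local Notation C := R[i].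
Local Notation V := 'rV[F]_n.
Local Notation D := ((V -> C) -> C).
Local Notation ind := (@ball_ind R F v n).

Lemma chiD a b : chi (a + b) = chi a * chi b.
Proof. by case: Hchi. Qed.

Lemma chi_integral x : inball v 0 x -> chi x = 1.
Proof. by case: Hchi => _ h /h. Qed.

Lemma chi0 : chi 0 = 1.
Proof. by apply: chi_integral; left. Qed.

Lemma chi_neq0 x : chi x != 0.
Proof.
apply/eqP => h; have := chiD x (- x).
by rewrite subrr chi0 h mul0r => /eqP; rewrite oner_eq0.
Qed.

Lemma chi_dot_integral k l (x y : V) :
  0 <= k + l -> inballn v k x -> inballn v l y -> chi (- dot x y) = 1.
Proof.
move=> kl hx hy; apply: chi_integral; apply: (inballN HF).
by apply: inball_le kl _; exact: (inball_dot HF).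
Qed.

Definition wave (a : V) (k : int) (eta x : V) : C := ind a k x * chi (- dot x eta).

Lemma char_loc_const (eta : V) : loc_const v (fun x => chi (- dot x eta)).
Proof.
move=> x; have [m hm] := inballn_ex v eta; exists (- m) => y hy.
rewrite dotDl opprD chiD (chi_dot_integral _ hy hm) ?mulr1 //; lia.
Qed.

Lemma schwartz_char (f : V -> C) eta :
  is_schwartz v f -> is_schwartz v (fun x => f x * chi (- dot x eta)).
Proof. by move=> sf; apply: schwartzM => //; exact: char_loc_const. Qed.

Lemma wave_schwartz a k eta : is_schwartz v (wave a k eta).
Proof. by apply: schwartz_char; exact: (ball_ind_schwartz _ HF). Qed.

Lemma wave_freq0 a k : wave a k 0 = ind a k.
Proof. by apply: funext => x; rewrite /wave dot0r oppr0 chi0 mulr1. Qed.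

Lemma wave_center a b k eta : inballn v k (b - a) -> wave b k eta = wave a k eta.
Proof.
move=> h; apply: funext => x; congr (_ * _); apply: ball_ind_eq.
split=> hx; first exact: (inballn_subD HF hx h).
exact: (inballn_subD HF hx (inballn_subC HF h)).
Qed.

Lemma dist0 (u : D) : is_distribution v u -> u (fun _ => 0) = 0.
Proof.
move=> du; have s0 := @schwartz0 R F v n; have := du (-1) _ _ s0 s0.
have -> : (fun _ : V => -1 * 0 + 0 : C) = fun _ => 0.
  by apply: funext => _; rewrite mulr0 addr0.
by rewrite mulN1r addNr.
Qed.

Lemma distZ (u : D) (c : C) f : is_distribution v u -> is_schwartz v f ->
  u (fun x => c * f x) = c * u f.
Proof.
move=> du sf; have := du c _ _ sf (@schwartz0 R F v n).
rewrite (dist0 du) addr0 => <-; congr u.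
by apply: funext => x; rewrite addr0.
Qed.

Definition annihilates (u : D) (f : V -> C) : Prop := is_schwartz v f /\ u f = 0.

Lemma annihilates0 u : is_distribution v u -> annihilates u (fun _ => 0).
Proof. by move=> du; split; [exact: schwartz0|exact: dist0]. Qed.

Lemma annihilates_lin u : is_distribution v u -> forall c f g,
  annihilates u f -> annihilates u g -> annihilates u (fun x => c * f x + g x).
Proof.
move=> du c f g [sf uf] [sg ug]; split; first exact: schwartz_lin.
by rewrite du // uf ug mulr0 addr0.
Qed.

(** A packet is the finite sum of the packets of the same frequency on the balls of a subdivision;
    induction on [j - k] subdivides once per step. *)
Lemma dist_wave_refine (u : D) a k j eta : is_distribution v u -> k <= j ->
  (forall b, inballn v k (b - a) -> u (wave b j eta) = 0) -> u (wave a k eta) = 0.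
Proof.
move=> du kj.
have {kj} [d ->] : exists d : nat, j = k + d%:Z by exists `|j - k|%N; lia.
elim: d k a => [|d IH] k a H.
  by move: H; rewrite addr0; apply; rewrite subrr; exact: inballn0.
have [T [b [bP bE]]] := @ball_subdivide R F v w q n HF a k.
have -> : wave a k eta = fun x => \sum_t wave (b t) (k + 1) eta x.
  by apply: funext => x; rewrite /wave bE mulr_suml.
suff [] : annihilates u (fun x => \sum_t wave (b t) (k + 1) eta x) by [].
apply: lin_closed_sum => [||t]; first exact: annihilates0.
  exact: annihilates_lin.
split; first exact: wave_schwartz.
apply: IH => c hc; have -> : k + 1 + d%:Z = k + d.+1%:Z by lia.
apply: H; apply: (inballn_subD HF) (bP t).
by apply: inballn_le hc; lia.
Qed.

(** * The Fourier transform on packets, Schwartz functions and distributions *)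

Hypothesis HI : is_haar_integral v I.
Hypothesis Hsd : self_dual v chi I.

Lemma haar_dist : is_distribution v I.
Proof. by case: HI. Qed.

Lemma haar_shift f a : is_schwartz v f -> I (fun x => f (x + a)) = I f.
Proof. by case: HI => _ h _ _; exact: h. Qed.

(** For [z] in the dual ball the character is constant on the ball of integration. Otherwise a
    translation preserving that ball multiplies the integral by a factor other than 1, which forces
    it to vanish. *)
Lemma haar_wave a k z :
  I (wave a k z) = I (ind 0 k) * chi (- dot a z) * ind 0 (- k) z.
Proof.
have dI := haar_dist; have sw := wave_schwartz a k z.
case: (pselect (inballn v (- k) z)) => hz.
  have -> : wave a k z = fun x => chi (- dot a z) * ind a k x.
    apply: funext => x; rewrite /wave mulrC.
    case: (pselect (inballn v k (x - a))) => hx; last by rewrite ball_ind0 // !mulr0.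
    rewrite -{1}(subrK a x) dotDl opprD chiD (chi_dot_integral _ hx hz) ?mul1r //.
    by lia.
  rewrite distZ //; last exact: (ball_ind_schwartz _ HF).
  rewrite [ind 0 (- k) z]ball_ind1 ?subr0 // mulr1 mulrC; congr (_ * _).
  rewrite -(haar_shift a (ball_ind_schwartz _ HF a k)); congr I.
  by apply: funext => x; apply: ball_ind_eq; rewrite subr0 addrK.
rewrite [ind 0 (- k) z]ball_ind0 ?subr0 // mulr0.
have [i hi] : exists i, ~ inball v (- k) (z ord0 i).
  by apply: contrapT => h; apply: hz => i; apply: contrapT => hi; apply: h; exists i.
(* This single translation suffices: as the kernel of [chi] is exactly the ring of integers,
   [chi (- dot y z) = 1] would make [w ^ k * z ord0 i] integral, contrary to the choice of [i]. *)
pose y : V := w ^ k *: delta_mx ord0 i.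
have yz : dot y z = w ^ k * z ord0 i.
  rewrite dotZl; congr (_ * _); rewrite /dot (bigD1 i) //= big1 => [|j ji].
    by rewrite mxE !eqxx mul1r addr0.
  by rewrite mxE (negbTE ji) andbF mul0r.
have hy : inballn v k y.
  move=> j; rewrite /y !mxE; case: (_ && _); last by rewrite mulr0; left.
  by rewrite mulr1; right; rewrite (val_unif_expz HF).
have : I (fun x => wave a k z (x + y)) = chi (- dot y z) * I (wave a k z).
  rewrite -distZ //; congr I; apply: funext => x.
  have -> : wave a k z (x + y) = ind a k x * (chi (- dot x z) * chi (- dot y z)).
    rewrite /wave dotDl opprD chiD; congr (_ * _); apply: ball_ind_eq.
    rewrite addrAC; split=> h; last exact: (inballnD HF).
    by rewrite -[x - a](addrK y); exact: (inballnB HF).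
  by rewrite /wave; ring.
rewrite haar_shift // => /eqP.
rewrite -subr_eq0 -{1}[I (wave a k z)]mul1r -mulrBl mulf_eq0 => /orP[|/eqP //].
rewrite subr_eq0 => /eqP chi1; exfalso; apply: hi.
have /(inballN HF) : inball v 0 (- dot y z) by case: Hchi => _ h; apply/h.
rewrite opprK yz -{1}(addNr (v (w ^ k))) (inball_scale HF) ?(unif_expz_neq0 HF) //.
by rewrite (val_unif_expz HF).
Qed.

(** The Fourier kernel shifts the frequency to [eta + z]. In the integral of the shifted packet, the
    cutoff on [eta + z] becomes the ball about [- eta], and the phase at the center [a] becomes the
    new frequency. *)
Lemma fourier_wave a k eta :
  fourier chi I (wave a k eta) =
  fun z => I (ind 0 k) * chi (- dot a eta) * wave (- eta) (- k) a z.
Proof.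
apply: funext => z; rewrite /fourier.
have -> : (fun x => wave a k eta x * chi (- dot x z)) = wave a k (eta + z).
  by apply: funext => x; rewrite /wave dotDr opprD chiD mulrA.
rewrite haar_wave dotDr opprD chiD /wave [dot z a]dotC.
have -> : ind 0 (- k) (eta + z) = ind (- eta) (- k) z.
  by apply: ball_ind_eq; rewrite subr0 opprK addrC.
by ring.
Qed.

(** A zero volume would kill the Fourier transform of the indicator, whereas by self-duality the
    double transform takes the value 1 at 0. *)
Lemma haar_ball_neq0 k : I (ind 0 k) != 0.
Proof.
apply/eqP => c0; have := Hsd (wave_schwartz 0 k 0) 0.
rewrite fourier_wave c0 /fourier.
have -> : (fun x : V => 0 * chi (- dot (0 : V) 0) * wave (- 0) (- k) 0 x *
    chi (- dot x 0)) = fun _ => 0 by apply: funext => x; rewrite !mul0r.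
rewrite (dist0 haar_dist) oppr0 wave_freq0 ball_ind1 ?subr0; last exact: inballn0.
by move/eqP; rewrite eq_sym oner_eq0.
Qed.

Lemma fourier_lin (c : C) f g : is_schwartz v f -> is_schwartz v g ->
  fourier chi I (fun x => c * f x + g x) =
  fun z => c * fourier chi I f z + fourier chi I g z.
Proof.
move=> sf sg; apply: funext => z; rewrite /fourier -haar_dist.
- by congr I; apply: funext => x; ring.
- exact: schwartz_char.
- exact: schwartz_char.
Qed.

Lemma fourier_schwartz f : is_schwartz v f -> is_schwartz v (fourier chi I f).
Proof.
move=> sf.
(* The induction predicate also carries the Schwartz property of the function itself, which
   linearity of the transform requires. *)
suff [] : is_schwartz v f /\ is_schwartz v (fourier chi I f) by [].
apply: (schwartz_ind HF (J := 0)
  (P := fun g => is_schwartz v g /\ is_schwartz v (fourier chi I g)) sf).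
- split; first exact: schwartz0.
  have -> : fourier chi I (fun _ => 0) = fun _ => 0; last exact: schwartz0.
  apply: funext => z; rewrite /fourier -[RHS](dist0 haar_dist); congr I.
  by apply: funext => x; rewrite mul0r.
- move=> c g h [sg sFg] [sh sFh]; split; first exact: schwartz_lin.
  by rewrite fourier_lin //; exact: schwartz_lin.
- move=> a k _ _ _; rewrite -wave_freq0; split; first exact: wave_schwartz.
  rewrite fourier_wave.
  have -> : (fun z => I (ind 0 k) * chi (- dot a 0) * wave (- 0) (- k) a z) =
      fun z => I (ind 0 k) * chi (- dot a 0) * wave (- 0) (- k) a z + 0.
    by apply: funext => z; rewrite addr0.
  apply: (@schwartz_lin R F v n _ _ (fun _ => 0)); first exact: wave_schwartz.
  exact: schwartz0.
Qed.

Lemma fourier_dist_distribution u :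
  is_distribution v u -> is_distribution v (fourier_dist chi I u).
Proof.
move=> du a f g sf sg; rewrite /fourier_dist fourier_lin // du //.
  exact: fourier_schwartz.
exact: fourier_schwartz.
Qed.

Lemma fourier_dist_wave u a k eta : is_distribution v u ->
  (fourier_dist chi I u (wave a k eta) = 0 <-> u (wave (- eta) (- k) a) = 0).
Proof.
move=> du; rewrite /fourier_dist fourier_wave distZ //; last exact: wave_schwartz.
split=> [/eqP|->]; last by rewrite mulr0.
rewrite !mulf_eq0 (negbTE (haar_ball_neq0 k)) (negbTE (chi_neq0 _)) /=.
by move/eqP.
Qed.

(* The Fourier dual of [dist_wave_refine]: shrinking the ball in space amounts to
   averaging over a ball of frequencies. *)
Lemma dist_wave_restrict (u : D) a b k j eta : is_distribution v u ->
  k <= j -> inballn v k (b - a) ->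
  (forall eta', inballn v (- j) (eta' - eta) -> u (wave a k eta') = 0) ->
  u (wave b j eta) = 0.
Proof.
move=> du kj ba H; have dFu := fourier_dist_distribution du.
rewrite -[b]opprK -[j]opprK; apply/(fourier_dist_wave _ _ _ du).
apply: (dist_wave_refine (j := - k) dFu) => [|eta' heta']; first by lia.
apply/(fourier_dist_wave _ _ _ du); rewrite !opprK (wave_center _ ba).
exact: H.
Qed.

End Fourier.

(** * Homogeneity expressed through wave packets *)

Section WaveFront.
Set Implicit Arguments.
Unset Strict Implicit.
Context (R : realType) (F : fieldType) (v : F -> int) (w : F) (q n : nat).
Context (chi : F -> R[i]) (I : ('rV[F]_n -> R[i]) -> R[i]) (Lam : F -> Prop).
Hypothesis HF : is_nonarch_local_field_char0 v w q.
Hypothesis Hchi : is_char_kernel_o v chi.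
Hypothesis HL : is_Lambda Lam w.
Hypothesis HI : is_haar_integral v I.
Hypothesis Hsd : self_dual v chi I.
Local Notation C := R[i].
Local Notation V := 'rV[F]_n.
Local Notation D := ((V -> C) -> C).
Local Notation W := (@wave R F v n chi).
Local Notation ind := (@ball_ind R F v n).
Local Notation Fou := (fourier_dist chi I).

Lemma Lam_neq0 l : Lam l -> l != 0.
Proof. by case: HL => -[h _] _ _ _ _; exact: h. Qed.

Lemma Lam_inv l : Lam l -> Lam l^-1.
Proof. by case: HL => _ _ h _ _; exact: h. Qed.

Lemma Lam_unif_expz (k : int) : Lam (w ^ k).
Proof.
case: (HL) => -[_ L1] LM LV Lw _.
have Lexp (m : nat) : Lam (w ^+ m).
  by elim: m => [//|m IH]; rewrite exprS; exact: LM.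
case: k => m; first exact: Lexp.
by rewrite NegzE -exprnN; apply: LV; exact: Lexp.
Qed.

(** Only the vanishing is recorded, so the degree and the Jacobian factor disappear and the same
    condition can pass to the Fourier transform. *)
Definition wave_homogeneous (u : D) : Prop := forall l (a : V) (k : int) (eta : V), Lam l ->
  (u (W (l *: a) (k + v l) (l^-1 *: eta)) = 0 <-> u (W a k eta) = 0).

Lemma homogeneous_wave (u : D) : is_distribution v u ->
  is_homogeneous v q Lam u -> wave_homogeneous u.
Proof.
move=> du [chiL [_ chiL0 hu]] l a k eta Ll; have l0 := Lam_neq0 Ll.
have sw := @wave_schwartz R F v w q n chi HF Hchi.
have := hu l _ Ll (sw a k eta).
have -> : (fun x => (absF v R q l)^-1 ^+ n * W a k eta (l^-1 *: x)) =
    fun x => (absF v R q l)^-1 ^+ n * W (l *: a) (k + v l) (l^-1 *: eta) x.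
  apply: funext => x; congr (_ * _); rewrite /wave dotZl dotZr.
  congr (_ * _); rewrite /ball_ind; congr (nat_of_bool _)%:R.
  apply: asbool_equiv_eq; rewrite -(inballn_scale HF _ _ l0).
  by rewrite scalerBr scalerA divff // scale1r.
rewrite (distZ _ du (sw _ _ _)) => e.
(* Since [q > 1], the absolute value of [l] is a power of a nonzero number; both scalars in [e] are
   then nonzero and can be cancelled. *)
have absl0 : (absF v R q l)^-1 ^+ n != 0.
  rewrite expf_neq0 // invr_neq0 // /absF (negbTE l0) expfz_neq0 //.
  by case: HF => -[_ _ _ [q1 _] _] _; rewrite pnatr_eq0; lia.
split=> h; move: e; rewrite h mulr0.
  by move/esym/eqP; rewrite mulf_eq0 (negbTE (chiL0 _ Ll)) => /eqP.
by move/eqP; rewrite mulf_eq0 (negbTE absl0) => /eqP.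
Qed.

(** Position and frequency trade places under the transform, so homogeneity under [l] becomes that
    of [u] under [l^-1]. *)
Lemma fourier_wave_homogeneous (u : D) : is_distribution v u ->
  wave_homogeneous u -> wave_homogeneous (Fou u).
Proof.
move=> du hu l a k eta Ll; rewrite !(fourier_dist_wave HF Hchi HI Hsd _ _ _ du).
rewrite -(hu _ (- eta) (- k) a (Lam_inv Ll)).
by rewrite scalerN invrK (valV HF) ?Lam_neq0 // opprD.
Qed.

(** * Support and wave front set as vanishing conditions on packets *)

Definition null_near (u : D) (x : V) : Prop := exists k : int,
  forall j a, k <= j -> inballn v k (a - x) -> u (W a j 0) = 0.

(** A Schwartz function supported in the ball of exponent [k] about [x] is a combination of
    indicators of balls of exponent at least [k] with centers in its support; these are the packets
    of frequency 0 in [null_near]. *)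
Lemma dsuppP (u : D) x : is_distribution v u -> dsupp v u x <-> ~ null_near u x.
Proof.
move=> du; rewrite /dsupp; split=> h [k hk]; apply: h; exists k.
  move=> f sf hf.
  suff [] : annihilates v u f by [].
  apply: (schwartz_ind HF (J := k) sf).
  - exact: annihilates0.
  - exact: annihilates_lin.
  move=> a j kj /hf ax _; rewrite -(wave_freq0 Hchi).
  by split; [exact: (wave_schwartz HF Hchi)|exact: hk].
move=> j a kj ax; apply: hk; first exact: (wave_schwartz HF Hchi).
move=> y; rewrite (wave_freq0 Hchi) => /ball_ind_neq0 ya.
by apply: (inballn_subD HF) ax; apply: inballn_le ya.
Qed.

(** The tested value is the Fourier transform of [u] cut off to one fixed ball, taken at [l *: eta].
    The bound [v l <= N] means that [l] is large, so this is vanishing far out in a conic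
    neighbourhood of [xi]. *)
Definition microsmooth (u : D) (x xi : V) : Prop := exists k m N : int,
  forall l eta, Lam l -> v l <= N -> inballn v m (eta - xi) ->
    u (W x k (l *: eta)) = 0.

(** Frequencies differing by an element of the dual ball define the same character on the support of
    [phi]. *)
Lemma fourier_cs_const (u : D) phi K (y a : V) :
  (forall x, phi x != 0 -> inballn v K x) -> inballn v (- K) (y - a) ->
  fourier_cs chi phi u y = fourier_cs chi phi u a.
Proof.
move=> hphi hya; rewrite /fourier_cs; congr u; apply: funext => x.
have [->|/hphi hx] := eqVneq (phi x) 0; first by rewrite !mul0r.
rewrite -{1}(subrK a y) dotDr opprD (chiD Hchi).
by rewrite (chi_dot_integral HF Hchi _ hx hya) ?mul1r //; lia.
Qed.

(** The transform is constant on cosets of a fixed ball, so its nonvanishing set is already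
    closed. *)
Lemma fsupp_fourier_cs (u : D) phi y : is_schwartz v phi ->
  fsupp v (fourier_cs chi phi u) y <-> fourier_cs chi phi u y != 0.
Proof.
move=> [_ [K hK]]; split=> [/(_ (- K)) [a [ha ya]]|h k].
  by rewrite (fourier_cs_const _ hK ya).
by exists y; split=> //; rewrite subrr; exact: inballn0.
Qed.

Lemma nonzero_away (xi : V) : xi != 0 ->
  exists M : int, forall eta, inballn v M (eta - xi) -> ~ inballn v M eta.
Proof.
move=> xi0.
have [i hi] : exists i, xi ord0 i != 0.
  apply: contrapT => h; move/eqP: xi0; apply; apply/rowP => i; rewrite mxE.
  by apply/eqP; apply: contrapT => /negP hi; apply: h; exists i.
(* One more than the valuation of a nonzero coordinate: the ball of this exponent about 0 excludes
   [xi], hence is disjoint from the one about [xi]. *)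
exists (v (xi ord0 i) + 1) => eta h heta.
have := inballnB HF heta h; rewrite subKr => /(_ i) [/eqP|].
  by rewrite (negbTE hi).
by lia.
Qed.

Lemma microsmooth_not_WF (u : D) x xi : xi != 0 ->
  microsmooth u x xi -> ~ WF v Lam chi u x xi.
Proof.
move=> xi0 [k [m [N hu]]] [_ /(_ (ind x k))].
have sphi : is_schwartz v (ind x k) := ball_ind_schwartz _ HF x k.
rewrite ball_ind1 ?subrr; last exact: inballn0.
move=> /(_ sphi (oner_neq0 _)) [_]; apply.
have [M hM] := nonzero_away xi0.
have [M0 hM0] := inballn_ex v xi.
(* The cone is the [Lam]-saturation of a ball about [xi]: [m] puts the ball where the vanishing
   hypothesis holds, and [M] keeps it away from 0. *)
exists (fun y => exists l eta,
  [/\ Lam l, inballn v (Num.max m M) (eta - xi) & y = l *: eta]).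
case: (HL) => _ LM _ _ _; split.
- split=> [y [l [eta [Ll heta ->]]]|l y Ll [l' [eta [Ll' heta ->]]]]; last first.
    by exists (l * l'), eta; rewrite scalerA; split=> //; exact: LM.
  rewrite scaler_eq0 (negbTE (Lam_neq0 Ll)) /=; apply/eqP => eta0.
  apply: (hM eta); first by apply: inballn_le heta; lia.
  by rewrite eta0; exact: inballn0.
- move=> y [l [eta [Ll heta ->]]]; exists (Num.max m M + v l) => t ht.
  have l0 := Lam_neq0 Ll.
  have tE : l *: (l^-1 *: t) = t by rewrite scalerA divff // scale1r.
  exists l, (eta + l^-1 *: t); split=> //; last by rewrite scalerDr tE.
  rewrite addrAC; apply: (inballnD HF) => //.
  by rewrite -(inballn_scale HF _ _ l0) tE.
- exists 1, xi; rewrite scale1r subrr; split=> //; last exact: inballn0.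
  by case: HL => -[].
(* All [eta] lie in the ball of exponent [Num.min M0 (Num.max m M)]; a nonzero transform at
   [l *: eta] forces [N < v l], which bounds that point. *)
exists (Num.min M0 (Num.max m M) + N) => y [[l [eta [Ll heta ->]]]].
move/(fsupp_fourier_cs _ _ sphi) => hy.
have lN : N < v l.
  rewrite ltNge; apply/negP => lN; move/eqP: hy; apply.
  by apply: (hu l eta) => //; apply: inballn_le heta; lia.
apply: (@inballn_le _ _ _ _ (Num.min M0 (Num.max m M) + v l)); first by lia.
apply/(inballn_scale HF _ _ (Lam_neq0 Ll)).
rewrite -(subrK xi eta); apply: (inballnD HF).
  by apply: inballn_le heta; lia.
by apply: inballn_le hM0; lia.
Qed.

Lemma not_microsmooth_WF (u : D) x xi : is_distribution v u -> xi != 0 ->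
  ~ microsmooth u x xi -> WF v Lam chi u x xi.
Proof.
move=> du xi0 nms; split=> // phi sphi phix; split=> //.
move=> [G [[_ Gcone] Gopen Gxi [K hK]]]; apply: nms.
case: (sphi) => lphi [K0 hK0].
have [k0 hk0] := lphi x; have [m0 hm0] := Gopen xi Gxi.
have [M hM] := nonzero_away xi0.
pose k := Num.max k0 K0; pose m := Num.max M m0.
(* For [z] within the ball of exponent [- k] about [l *: eta], the bound [- k - m] keeps [l^-1 *: z]
   close to [xi], so [z] is in [G]; the bound [K - M] puts [z] outside the ball of exponent [K]. *)
exists k, m, (Num.min (- k - m) (K - M)) => l eta Ll hl heta.
have l0 := Lam_neq0 Ll.
pose u' (f : V -> C) := u (fun y => phi y * f y).
have sM f : is_schwartz v f -> is_schwartz v (fun y => phi y * f y).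
  by move=> [lf _]; exact: schwartzM.
have du' : is_distribution v u'.
  move=> c f g sf sg; rewrite /u' -du; [|exact: sM|exact: sM].
  by congr u; apply: funext => y; ring.
(* [phi] is constant on the ball about [x], so there the cutoff by [phi] is a nonzero scalar. *)
have u'x z : u' (W x k z) = phi x * u (W x k z).
  rewrite -(distZ _ du (wave_schwartz HF Hchi _ _ _)).
  congr u; apply: funext => y; rewrite /wave !mulrA; congr (_ * _).
  case: (pselect (inballn v k (y - x))) => hy; last by rewrite !ball_ind0 // !mulr0.
  congr (_ * _); rewrite -(subrK x y) addrC; apply: hk0.
  by apply: inballn_le hy; rewrite /k; lia.
suff /eqP : u' (W x k (l *: eta)) = 0.
  by rewrite u'x mulf_eq0 (negbTE phix) => /eqP.
(* The passage is from the ball about 0 containing the support of [phi], where packets compute the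
   transform of [phi u], to the small ball about [x]. *)
apply: (dist_wave_restrict HF Hchi HI Hsd (a := 0) (k := K0) du').
- by rewrite /k; lia.
- by rewrite subr0; exact: hK0.
move=> z hz.
have -> : u' (W 0 K0 z) = fourier_cs chi phi u z.
  congr u; apply: funext => y; rewrite /wave mulrA; congr (_ * _).
  have [->|/hK0 hy] := eqVneq (phi y) 0; first by rewrite mul0r.
  by rewrite ball_ind1 ?mulr1 // subr0.
apply: contrapT => /eqP /(fsupp_fourier_cs _ _ sphi) fz.
pose z' := l^-1 *: z.
have zE : z = l *: z' by rewrite scalerA divff // scale1r.
have hz' : inballn v m (z' - xi).
  apply: (inballn_subD HF) heta.
  apply/(inballn_scale HF _ _ l0); rewrite scalerBr -zE.
  by apply: inballn_le hz; lia.
apply: (hM z'); first by apply: inballn_le hz'; rewrite /m; lia.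
apply/(inballn_scale HF _ _ l0); rewrite -zE.
apply: (@inballn_le _ _ _ _ K); first by lia.
apply: hK; split=> //; rewrite zE; apply: Gcone => //.
rewrite -(subrK xi z') addrC; apply: hm0.
by apply: inballn_le hz'; rewrite /m; lia.
Qed.

Lemma WFP (u : D) x xi : is_distribution v u -> xi != 0 ->
  WF v Lam chi u x xi <-> ~ microsmooth u x xi.
Proof.
move=> du xi0; split=> [h ms|]; first exact: microsmooth_not_WF ms h.
exact: not_microsmooth_WF.
Qed.

(** * Exchange of the vanishing conditions under the Fourier transform *)

Lemma null_near_fourier (u : D) xi : is_distribution v u -> wave_homogeneous u ->
  null_near (Fou u) xi <-> microsmooth u 0 xi.
Proof.
move=> du hu.
have Fu j a : Fou u (W a j 0) = 0 <-> u (W 0 (- j) a) = 0.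
  by rewrite (fourier_dist_wave HF Hchi HI Hsd _ _ _ du) oppr0.
(* A packet centered at 0 keeps its center under dilation, so enlarging its frequency amounts to
   enlarging its ball. *)
have scale l k a : Lam l -> u (W 0 k (l *: a)) = 0 <-> u (W 0 (k + v l) a) = 0.
  move=> Ll; rewrite -(hu _ _ _ (l *: a) Ll) scaler0 scalerA mulVf ?Lam_neq0 //.
  by rewrite scale1r.
split=> [[k hk]|[k [m [N H]]]].
  exists 0, k, (- k) => l eta Ll hl heta; apply/scale => //.
  rewrite -[0 + v l]opprK; apply/Fu; apply: hk => //; lia.
exists (Num.max m (- N - k)) => j a hj ha; apply/Fu.
(* Because the uniformizer lies in [Lam], every integer exponent is reached from the single [k] by a
   dilation in [Lam]. *)
have -> : - j = k + v (w ^ (- j - k)) by rewrite (val_unif_expz HF); lia.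
apply/scale; first exact: Lam_unif_expz.
apply: H; first exact: Lam_unif_expz.
  by rewrite (val_unif_expz HF); lia.
by apply: inballn_le ha; lia.
Qed.

Lemma microsmooth_fourier (u : D) x xi : is_distribution v u -> wave_homogeneous u ->
  microsmooth u x xi -> microsmooth (Fou u) xi (- x).
Proof.
(* Position and frequency tolerances swap roles. The bound [- m - k] ensures [k <= - m - v l], so
   the rescaled packet sits on a ball inside the one about [x]. *)
move=> du hu [k [m [N H]]]; exists m, k, (Num.min N (- m - k)).
move=> l y Ll hl hy; have l0 := Lam_neq0 Ll.
apply/(fourier_dist_wave HF Hchi HI Hsd _ _ _ du).
rewrite -(hu _ _ _ _ (Lam_inv Ll)) invrK scalerN scalerA mulVf // scale1r.
rewrite (valV HF) //.
apply: (dist_wave_restrict HF Hchi HI Hsd (a := x) (k := k) du); first by lia.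
  by rewrite -opprD; apply: (inballnN HF); rewrite -[x]opprK.
move=> z hz.
have zE : z = l *: (l^-1 *: z) by rewrite scalerA divff // scale1r.
rewrite zE; apply: H => //; first by lia.
apply/(inballn_scale HF _ _ l0); rewrite scalerBr -zE.
by apply: inballn_le hz; lia.
Qed.

(** Fourier inversion on packets: the double transform is reflection, which gives the converse
    implications. *)
Lemma fourier_fourier_wave (u : D) a k eta : is_distribution v u ->
  Fou (Fou u) (W a k eta) = 0 <-> u (W (- a) k (- eta)) = 0.
Proof.
move=> du; have dFu := fourier_dist_distribution HF Hchi HI du.
rewrite (fourier_dist_wave HF Hchi HI Hsd _ _ _ dFu).
by rewrite (fourier_dist_wave HF Hchi HI Hsd _ _ _ du) opprK.
Qed.

Lemma microsmooth_fourier_fourier (u : D) x xi : is_distribution v u ->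
  microsmooth (Fou (Fou u)) (- x) (- xi) -> microsmooth u x xi.
Proof.
move=> du [k [m [N H]]]; exists k, m, N => l eta Ll hl heta.
rewrite -[x]opprK -[l *: eta]opprK; apply/(fourier_fourier_wave _ _ _ du).
by rewrite -scalerN; apply: H => //; rewrite -opprD; exact: (inballnN HF).
Qed.

Lemma null_near_fourier_fourier (u : D) x : is_distribution v u ->
  null_near (Fou (Fou u)) (- x) <-> null_near u x.
Proof.
move=> du; split=> -[k H]; exists k => j a kj ha.
  rewrite -[a]opprK -[0]oppr0; apply/(fourier_fourier_wave _ _ _ du).
  by apply: H => //; rewrite -opprD; exact: (inballnN HF).
apply/(fourier_fourier_wave _ _ _ du); rewrite oppr0; apply: H => //.
by rewrite -opprD; apply: (inballnN HF); rewrite -[x]opprK.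
Qed.

End WaveFront.

Theorem theoremA1 (R : realType) (F : fieldType) (v : F -> int) (w : F) (q : nat)
  (chi : F -> R[i]) (Lam : F -> Prop) (n : nat)
  (I : ('rV[F]_n -> R[i]) -> R[i]) (u : ('rV[F]_n -> R[i]) -> R[i]) :
  is_nonarch_local_field_char0 v w q ->
  is_char_kernel_o v chi ->
  is_Lambda Lam w ->
  is_haar_integral v I ->
  self_dual v chi I ->
  is_distribution v u ->
  is_homogeneous v q Lam u ->
  [/\ forall x xi : 'rV[F]_n, x != 0 -> xi != 0 ->
        (WF v Lam chi u x xi <-> WF v Lam chi (fourier_dist chi I u) xi (- x)),
      forall x : 'rV[F]_n, x != 0 ->
        (dsupp v u x <-> WF v Lam chi (fourier_dist chi I u) 0 (- x)) &
      forall xi : 'rV[F]_n, xi != 0 ->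
        (dsupp v (fourier_dist chi I u) xi <-> WF v Lam chi u 0 xi)].
Proof.
move=> HF Hchi HL HI Hsd du homu.
have hu := homogeneous_wave HF Hchi HL du homu.
have dFu := fourier_dist_distribution HF Hchi HI du.
have dFFu := fourier_dist_distribution HF Hchi HI dFu.
have hFu := fourier_wave_homogeneous HF Hchi HL HI Hsd du hu.
have WFE := WFP HF Hchi HL HI Hsd.
split=> [x xi x0 xi0|x x0|xi xi0].
- rewrite !WFE ?oppr_eq0 //; split=> h ms; apply: h.
    (* Applied to the transform at [(xi, - x)], the one-way implication reaches the double transform
       at [(- x, - xi)], the reflection of [(x, xi)]. *)
    apply: (microsmooth_fourier_fourier HF Hchi HI Hsd du).
    exact: (microsmooth_fourier HF Hchi HL HI Hsd dFu hFu).
  exact: (microsmooth_fourier HF Hchi HL HI Hsd du hu).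
- rewrite (dsuppP HF Hchi _ du) WFE ?oppr_eq0 //.
  (* The second equivalence is the third one for the transform of [u] at [- x], after reflecting the
     double transform. *)
  rewrite -(null_near_fourier_fourier HF Hchi HI Hsd _ du).
  by rewrite (null_near_fourier HF Hchi HL HI Hsd _ dFu hFu).
- rewrite (dsuppP HF Hchi _ dFu) WFE //.
  by rewrite (null_near_fourier HF Hchi HL HI Hsd _ du hu).
Qed.
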